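(* With step size $\eta=1/L$, projected gradient descent on $\mathcal{C}_\sigma$ over $\mathcal{D}$, started from any point of $\mathcal{D}$, reaches an $\epsilon$-projected-critical point in $\mathcal{O}\!\left(\frac{\alpha L}{\epsilon^2}\right)$ iterations; i.e., within $\mathcal{O}(\alpha L/\epsilon^2)$ iterations some iterate $(a^{(t)},b^{(t)})$ satisfies $\|g(a^{(t)},b^{(t)})\|^2\le\epsilon^2$.
   Context: Truth values: $-1$ = True, $+1$ = False. Propositional variables $x\in\{\pm1\}^n$, real variables $y\in\mathbb{R}^m$; atoms $\alpha_i:\ \sum_j q_{i,j}y_j-q_{i,0}\bowtie_i0$ ($i=1,\dots,k$, $q_i\neq0$) with $\delta_i(y)=-1$ if $\alpha_i$ holds, else $+1$. $C$ is a finite set of constraints with weights $w_c>0$, $\alpha=\sum_cw_c$; $c$ is represented by $f_c(x,y)=\tilde f_c(x,\delta(y))\in\{\pm1\}$ with coefficients $\hat f_c(S,T)=\mathbb{E}_{(x,z)\text{ uniform}}[\tilde f_c(x,z)\prod_{i\in S}x_i\prod_{i\in T}z_i]$. For $\sigma>0$, $d_i(b)=\mathbb{E}_{y\sim\mathcal{N}(b,\sigma^2I)}[\delta_i(y)]$ and $\mathcal{C}_\sigma(a,b)=\sum_cw_c\sum_{S,T}\hat f_c(S,T)\prod_{i\in S}a_i\prod_{i\in T}d_i(b)$. $\mathcal{D}$ is the set of $(a,b)$ with $a\in[-1,1]^n$ and $b$ satisfying every constraint of $C$ consisting of a single atom without propositional variables. Projected gradient descent: $(a^{(t+1)},b^{(t+1)})=\mathrm{proj}_{\mathcal{D}}\big((a^{(t)},b^{(t)})-\eta\nabla\mathcal{C}_\sigma(a^{(t)},b^{(t)})\big)$,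 with projected gradient mapping $g(a,b)=\frac1\eta\big((a,b)-\mathrm{proj}_{\mathcal{D}}((a,b)-\eta\nabla\mathcal{C}_\sigma(a,b))\big)$. A point is $\epsilon$-projected-critical if $\|g(a,b)\|^2\le\epsilon^2$. $L=\sqrt{n+m\gamma^2}\,\alpha\sqrt{n+m}\max(1,\gamma)$ with $\gamma=\sqrt2\beta/(\sqrt\pi\sigma)$, $\beta$ the maximum number of atoms of a single constraint in which a given real variable has nonzero coefficient. *)

(* Defs.v *)
From HB Require Import structures.
From mathcomp Require Import all_boot all_order all_algebra.
From mathcomp Require Import all_classical all_reals all_analysis.
Set Implicit Arguments. Unset Strict Implicit. Unset Printing Implicit Defensive.
Import Order.TTheory GRing.Theory Num.Theory.
Local Open Scope ring_scope.

Inductive arel := RLt | RLe | REq | RGe | RGt.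

Section Defs.
Context {R : realType}.
(* n propositional variables, m real variables, k atoms, nc constraints. *)
Context {n m k nc : nat}.
Variables (q : 'I_k -> 'I_m -> R) (q0 : 'I_k -> R) (rl : 'I_k -> arel).
(* constraint c: its truth as a Boolean function of the propositional variables
   and of the truth values of the atoms (true = satisfied), its set of atoms,
   and its weight *)
Variables (phi : 'I_nc -> {ffun 'I_n -> bool} -> {ffun 'I_k -> bool} -> bool).
Variables (atoms : 'I_nc -> {set 'I_k}) (w : 'I_nc -> R).

Definition sgn (b : bool) : R := if b then -1 else 1.

Definition atom_holds (i : 'I_k) (y : 'I_m -> R) : bool :=
  let s := \sum_j q i j * y j - q0 i in
  match rl i with
  | RLt => s < 0 | RLe => s <= 0 | REq => s == 0 | RGe => 0 <= s | RGt => 0 < s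
  end.

Definition delta (i : 'I_k) (y : 'I_m -> R) : R := sgn (atom_holds i y).

Definition fourier (c : 'I_nc) (S : {set 'I_n}) (T : {set 'I_k}) : R :=
  ((2%:R : R) ^+ (n + k))^-1 *
  \sum_(x : {ffun 'I_n -> bool}) \sum_(z : {ffun 'I_k -> bool})
     (sgn (phi c x z) * \prod_(i in S) sgn (x i) * \prod_(i in T) sgn (z i)).

Definition upd {p : nat} (f : 'I_p -> R) (j : 'I_p) (t : R) : 'I_p -> R :=
  fun j' => if j' == j then t else f j'.

(* E_{y ~ N(b, s^2 I)} [F y], as the iterated integral over the independent
   coordinates y_j ~ N(b_j, s^2) *)
Fixpoint gauss_iter (b : 'I_m -> R) (s : R) (F : ('I_m -> R) -> R)
    (l : seq 'I_m) (y : 'I_m -> R) : R :=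
  match l with
  | [::] => F y
  | j :: l' => Rintegral (normal_prob (b j) s) setT
                 (fun x => gauss_iter b s F l' (upd y j x))
  end.

Definition gauss_exp (b : 'I_m -> R) (s : R) (F : ('I_m -> R) -> R) : R :=
  gauss_iter b s F (enum 'I_m) (fun _ => 0).

Definition dsmooth (sigma : R) (i : 'I_k) (b : 'I_m -> R) : R :=
  gauss_exp b sigma (delta i).

Definition Csig (sigma : R) (a : 'I_n -> R) (b : 'I_m -> R) : R :=
  \sum_(c : 'I_nc) w c *
    \sum_(S : {set 'I_n}) \sum_(T : {set 'I_k})
       (fourier c S T * \prod_(i in S) a i * \prod_(i in T) dsmooth sigma i b).

Definition point := (('I_n -> R) * ('I_m -> R))%type.

Definition pt_sub (p r : point) : point :=
  (fun j => p.1 j - r.1 j, fun j => p.2 j - r.2 j).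
Definition pt_scale (e : R) (p : point) : point :=
  (fun j => e * p.1 j, fun j => e * p.2 j).
Definition sqnorm (p : point) : R :=
  \sum_j p.1 j ^+ 2 + \sum_j p.2 j ^+ 2.

Definition grad (sigma : R) (p : point) : point :=
  (fun j => derive1 (fun t => Csig sigma (upd p.1 j t) p.2) (p.1 j),
   fun j => derive1 (fun t => Csig sigma p.1 (upd p.2 j t)) (p.2 j)).

Definition single_atom (c : 'I_nc) (i : 'I_k) : Prop :=
  forall x z, phi c x z = z i.

Definition inD (p : point) : Prop :=
  (forall j, -1 <= p.1 j <= 1) /\
  (forall c i, single_atom c i -> atom_holds i p.2).

Definition is_projD (proj : point -> point) : Prop :=
  forall p, inD (proj p) /\
    forall r, inD r -> sqnorm (pt_sub (proj p) p) <= sqnorm (pt_sub r p).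

Definition pgd_step (proj : point -> point) (sigma eta : R) (p : point) : point :=
  proj (pt_sub p (pt_scale eta (grad sigma p))).
Definition gmap (proj : point -> point) (sigma eta : R) (p : point) : point :=
  pt_scale eta^-1 (pt_sub p (pgd_step proj sigma eta p)).

Definition alpha : R := \sum_c w c.
Definition beta : nat :=
  \max_(c : 'I_nc) \max_(j : 'I_m) #|[set i in atoms c | q i j != 0%R]|.
Definition gamma (sigma : R) : R :=
  Num.sqrt 2 * (beta%:R) / (Num.sqrt pi * sigma).
Definition Lconst (sigma : R) : R :=
  Num.sqrt (n%:R + m%:R * gamma sigma ^+ 2) * alpha * Num.sqrt ((n + m)%:R)
  * Num.max 1 (gamma sigma).

End Defs.

(* Main.v *)
Require Import Defs.
From HB Require Import structures.
From mathcomp Require Import all_boot all_order all_algebra.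
From mathcomp Require Import all_classical all_reals all_analysis.
From mathcomp Require Import measurable_realfun.
From mathcomp Require Import ring lra.
Import Order.TTheory GRing.Theory Num.Theory.
Import numFieldNormedType.Exports.
Local Open Scope classical_set_scope.
Local Open Scope ring_scope.

(* Each [d_i] is the Gaussian probability of a half-line (or of a point), as a
   function of a linear form in [b]: integrating out the coordinates one by one
   only convolves Gaussians. Hence [d_i] varies by at most [rho_i] and differs
   from its linearization by at most [rho_i^2 / 2], where
   [rho_i = sqrt 2 / (sqrt pi * sigma) * sum_(j | q_ij <> 0) |v_j|].
   The Fourier sum of a constraint is affine in each variable and bounded by 1
   on the cube, and so are all its discrete partial derivatives; changing one
   variable at a time shows that it differs from its linearization by at most
   [(sum_i rho_i)^2 / 2]. Summing over constraints gives the quadratic upper bound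
   for [C_sigma] with constant [alpha (n + m gamma^2) <= L], so that each
   projected step lowers [C_sigma] by at least [|g|^2 / (2 L)], while
   [|C_sigma| <= alpha]. *)

(** * Gaussian measures on the line *)

Section normal_prob_theory.
Context {R : realType}.
Implicit Types (m s c q b t : R).
Local Notation mu := (@lebesgue_measure R).

(** By uniqueness of Lebesgue measure it suffices to compare half-open intervals, whose length a
    translation preserves. *)
Lemma lebesgue_measure_shift c (A : set R) : measurable A ->
  pushforward mu ((fun x => x + c) : _ -> measurableTypeR R) A = mu A.
Proof.
move=> mA; apply/esym/lebesgue_measure_unique => //=.
  exact: measurable_funD.
move=> _ _ [[x y]] _ <-.
have -> : pushforward mu ((fun x => x + c) : _ -> measurableTypeR R) `]x, y]%classic
   = mu `]x - c, y - c]%classic.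
  congr (mu _); apply/seteqP; split => z /=; rewrite !in_itv/= => /andP[xz zy];
  apply/andP; split; lra.
rewrite !lebesgue_measure_itv/= !lte_fin ltrD2r.
by case: ifP => // _; rewrite -!EFinB; congr (_%:E); ring.
Qed.

Lemma normal_prob_shift m s c (A : set R) : s != 0 -> measurable A ->
  normal_prob (m + c) s A = normal_prob m s [set x : R | A (x + c)].
Proof.
move=> s0 mA; rewrite /normal_prob.
transitivity (\int[pushforward mu ((fun x : R => x + c)%R : _ -> measurableTypeR R)]_(x in A)
   (normal_pdf (m + c)%R s x)%:E)%E.
  apply: eq_measure_integral => //=; first exact: measurable_funD.
  by move=> ? B mB _; rewrite lebesgue_measure_shift.
rewrite ge0_integral_pushforward//=.
- apply: eq_integral => x _ /=; rewrite !normal_pdfE// /normal_fun.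
  by congr (_ * expR _)%:E; congr (- _ ^+ 2 / _); ring.
- exact: measurable_funD.
- by apply/measurable_EFinP/measurable_funTS; exact: measurable_normal_pdf.
- by move=> x _; rewrite lee_fin normal_pdf_ge0.
Qed.

(** The change of variables holds for the Radon-Nikodym derivative, which equals [normal_pdf] almost
    everywhere because both have the same integral over every measurable set. *)
Lemma ge0_integral_normal_prob m s (f : R -> \bar R) :
  measurable_fun setT f -> (forall x, 0 <= f x)%E ->
  (\int[normal_prob m s]_x f x = \int[mu]_x (f x * (normal_pdf m s x)%:E))%E.
Proof.
move=> mf f0; have ac := normal_prob_dominates m s.
rewrite -(Radon_Nikodym_SigmaFinite.change_of_variables ac)//.
have fint := Radon_Nikodym_SigmaFinite.f_integrable ac.
apply: ae_eq_integral => //.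
- by apply: emeasurable_funM => //; exact: (measurable_int mu).
- apply: emeasurable_funM => //.
  by apply/measurable_EFinP; exact: measurable_normal_pdf.
- apply: ae_eqe_mul2l => /=; apply: integral_ae_eq => //=.
  + by apply/measurable_EFinP; exact: measurable_normal_pdf.
  + by move=> E _ mE; rewrite -Radon_Nikodym_SigmaFinite.f_integral.
Qed.

(* Completing the square. *)
Lemma normal_pdf_mul b s t c q x y : s != 0 -> t != 0 ->
  let t' := Num.sqrt (t ^+ 2 + q ^+ 2 * s ^+ 2) in
  normal_pdf b s x * normal_pdf (c + q * x) t y =
  normal_pdf (c + q * b) t' y *
  normal_pdf ((b * t ^+ 2 + q * s ^+ 2 * (y - c)) / t' ^+ 2) (s * t / t') x.
Proof.
move=> s0 t0 t'.
have s2 : 0 < s ^+ 2 by rewrite exprn_even_gt0.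
have t2 : 0 < t ^+ 2 by rewrite exprn_even_gt0.
have D0 : 0 < t ^+ 2 + q ^+ 2 * s ^+ 2.
  by rewrite ltr_pwDl// mulr_ge0// sqr_ge0.
have t'2 : t' ^+ 2 = t ^+ 2 + q ^+ 2 * s ^+ 2 by rewrite sqr_sqrtr// ltW.
have t'0 : t' != 0 by rewrite gt_eqF// sqrtr_gt0.
have r0 : s * t / t' != 0 by rewrite !mulf_neq0// invr_eq0.
rewrite !normal_pdfE// /normal_peak /normal_fun.
rewrite [LHS]mulrACA [RHS]mulrACA; congr (_ * _).
  rewrite -!invfM -!sqrtrM; last 2 first.
  - by rewrite pmulrn_lge0// mulr_ge0 ?sqr_ge0// pi_ge0.
  - by rewrite pmulrn_lge0// mulr_ge0 ?sqr_ge0// pi_ge0.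
  congr (Num.sqrt _)^-1; rewrite expr_div_n exprMn t'2.
  by field; rewrite exprMn gt_eqF.
rewrite -!expRD; congr expR; rewrite expr_div_n exprMn !t'2.
field.
by rewrite s0 t0 exprMn gt_eqF.
Qed.

Lemma measurable_normal_pdf2 c q t : t != 0 ->
  measurable_fun setT (fun z : R * R => normal_pdf (c + q * z.1) t z.2).
Proof.
move=> t0; under eq_fun do rewrite normal_pdfE// /normal_fun.
apply: measurable_funM => //; apply: measurableT_comp => //=.
apply: measurable_funM => //; apply: measurableT_comp => //=.
apply: measurable_funX; apply: measurable_funB => //.
by apply: measurable_funD => //; apply: measurable_funM.
Qed.

Lemma normal_prob_indicE m s (A : set R) : measurable A ->
  normal_prob m s A = (\int[mu]_y (normal_pdf m s y * \1_A y)%:E)%E.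
Proof.
move=> mA; rewrite /normal_prob integral_mkcond; apply: eq_integral => y _.
by rewrite patchE indicE; case: ifPn => _; rewrite ?mulr1 ?mulr0.
Qed.

Lemma measurable_normal_prob_affine c q t (A : set R) : t != 0 ->
  measurable A -> measurable_fun setT (fun x => normal_prob (c + q * x) t A).
Proof.
move=> t0 mA; under eq_fun do rewrite normal_prob_indicE//.
apply: (@measurable_fun_fubini_tonelli_F _ _ _ _ R mu
  (fun z : R * R => (normal_pdf (c + q * z.1) t z.2 * \1_A z.2)%:E)).
- apply/measurable_EFinP; apply: measurable_funM.
    exact: measurable_normal_pdf2.
  by apply: measurableT_comp => //; exact: measurable_snd.
- by move=> z; rewrite lee_fin mulr_ge0// normal_pdf_ge0.
Qed.

(** Tonelli puts the integral over [x] inside; [normal_pdf_mul] then splits off a normal density in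
    [x], which integrates to 1, and leaves the normal density of the sum. *)
Lemma normal_prob_convolution b s t c q (A : set R) :
  s != 0 -> t != 0 -> measurable A ->
  (\int[normal_prob b s]_x normal_prob (c + q * x)%R t A =
   normal_prob (c + q * b)%R (Num.sqrt (t ^+ 2 + q ^+ 2 * s ^+ 2))%R A)%E.
Proof.
move=> s0 t0 mA; set t' := Num.sqrt _.
rewrite ge0_integral_normal_prob//; last first.
  exact: measurable_normal_prob_affine.
pose f := fun z : R * R =>
  (normal_pdf b s z.1 * normal_pdf (c + q * z.1) t z.2 * \1_A z.2)%:E.
have mf : measurable_fun setT f.
  apply/measurable_EFinP; apply: measurable_funM.
    apply: measurable_funM; last exact: measurable_normal_pdf2.
    by apply: (measurableT_comp (measurable_normal_pdf _ _) measurable_fst).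
  by apply: measurableT_comp => //; exact: measurable_snd.
have f0 z : (0 <= f z)%E.
  by rewrite lee_fin !mulr_ge0// normal_pdf_ge0.
transitivity (\int[mu]_x \int[mu]_y f (x, y))%E.
  apply: eq_integral => x _; rewrite normal_prob_indicE// -ge0_integralZr//.
  - by apply: eq_integral => y _; rewrite /f/= -EFinM mulrC mulrA.
  - apply/measurable_EFinP; apply: measurable_funM => //.
    exact: measurable_normal_pdf.
  - by move=> y _; rewrite lee_fin mulr_ge0// normal_pdf_ge0.
  - by rewrite lee_fin normal_pdf_ge0.
transitivity (\int[mu]_y \int[mu]_x f (x, y))%E.
  by transitivity (\int[mu \x mu]_z f z)%E; [rewrite fubini_tonelli1|rewrite fubini_tonelli2].
rewrite normal_prob_indicE//.
apply: eq_integral => y _; rewrite /f/=.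
under eq_integral do rewrite normal_pdf_mul// -/t' mulrAC EFinM.
rewrite ge0_integralZl//.
- by rewrite integral_normal_pdf mule1.
- by apply/measurable_EFinP; exact: measurable_normal_pdf.
- by move=> x _; rewrite lee_fin normal_pdf_ge0.
- by rewrite lee_fin mulr_ge0// normal_pdf_ge0.
Qed.

End normal_prob_theory.

(** * Gaussian expectation of an affine threshold *)

Section gauss_exp_threshold.
Context {R : realType}.

Lemma Rintegral_normal_prob_cst (b s r : R) :
  Rintegral (normal_prob b s) setT (fun=> r) = r.
Proof.
have P1 : normal_prob b s setT = 1%E by exact: probability_setT.
by rewrite Rintegral_cst// [X in r * X](congr1 fine P1) mulr1.
Qed.

(** Carries the form [1 - 2 * probability] of an expected sign through one more integration;
    boundedness of [g] gives integrability. *)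
Lemma Rintegral_normal_prob_affine (b s : R) (g : R -> \bar R) :
  measurable_fun setT g -> (forall x, 0 <= g x <= 1)%E ->
  Rintegral (normal_prob b s) setT (fun x => 1 - 2 * fine (g x)) =
  1 - 2 * fine (\int[normal_prob b s]_x g x)%E.
Proof.
move=> mg g01.
have gfin x : g x \is a fin_num.
  have /andP[g0 g1] := g01 x.
  by rewrite ge0_fin_numE// (le_lt_trans g1)// ltry.
have ig : (normal_prob b s).-integrable setT (fun x => (fine (g x))%:E).
  apply: (@le_integrable _ _ _ (normal_prob b s) setT measurableT _
            (cst 1%E)) => //.
  - by apply/measurable_EFinP; exact: measurableT_comp.
  - move=> x _ /=; rewrite normr1 lee_fin ger0_norm.
      by rewrite -lee_fin fineK//; case/andP: (g01 x).
    by rewrite fine_ge0//; case/andP: (g01 x).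
  - exact: finite_measure_integrable_cst.
rewrite RintegralB//.
- rewrite RintegralZl// Rintegral_normal_prob_cst.
  congr (1 - 2 * fine _); apply: eq_integral => x _; exact: fineK.
- exact: finite_measure_integrable_cst.
- by apply: eq_integrable (integrableZl measurableT 2 ig).
Qed.

Lemma sgnE (b : bool) : sgn b = 1 - 2 * b%:R :> R.
Proof. by case: b; rewrite /sgn /=; ring. Qed.

Context {m : nat} (q : 'I_m -> R) (c0 : R) (P : R -> bool).
Hypothesis mP : measurable [set x | P x].

Definition affine_form (y : 'I_m -> R) : R := \sum_j q j * y j - c0.

Lemma affine_form_upd y j x : affine_form (upd y j x) = affine_form (upd y j 0) + q j * x.
Proof.
rewrite /affine_form (bigD1 j)//= [in RHS](bigD1 j)//= /upd eqxx.
have H : \sum_(i < m | i != j) q i * (if i == j then x else y i) =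
         \sum_(i < m | i != j) q i * (if i == j then 0 else y i).
  by apply: eq_bigr => i /negbTE ->.
rewrite H; ring.
Qed.

Lemma measurable_scale_preimage (a : R) : measurable [set x | P (a * x)].
Proof.
have : measurable_fun setT (fun x : R => a * x) by exact: measurable_funM.
by move=> /(_ measurableT _ mP); rewrite setTI.
Qed.

(** Induction on [l], innermost integral first. Zero coefficients change nothing; the first nonzero
    one, [a], produces a Gaussian probability, and each later one convolves it with a further
    Gaussian. Dividing the form by [a] means that the base case needs only a translation, no
    rescaling. *)
Lemma gauss_iter_threshold (s : R) (l : seq 'I_m) :
  0 < s -> uniq l ->
  let F y := sgn (P (affine_form y)) in
  ((forall j, j \in l -> q j = 0) /\ forall b y, gauss_iter b s F l y = F y) \/
  exists a t, [/\ a != 0, 0 < t, t ^+ 2 * a ^+ 2 = s ^+ 2 * \sum_(j <- l) q j ^+ 2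
    & forall b y, gauss_iter b s F l y = 1 - 2 *
      fine (normal_prob (affine_form (fun j => if j \in l then b j else y j) / a) t
              [set x | P (a * x)])].
Proof.
move=> s0 + F; have sn0 : s != 0 by rewrite gt_eqF.
elim: l => [|j l IH] /=; first by left; split.
case/andP => jl /IH{IH} [[ql gl]|[a [t [a0 t0 ta gl]]]].
- have [qj|qj] := eqVneq (q j) 0.
    left; split => [i|b y]; first by rewrite inE => /orP[/eqP->//|/ql].
    under eq_Rintegral do rewrite gl /F affine_form_upd qj mul0r addr0.
    rewrite Rintegral_normal_prob_cst /F.
    congr (sgn (P (_ - _))); apply: eq_bigr => i _; rewrite /upd.
    by case: eqP => // ->; rewrite qj !mul0r.
  (* The first nonzero coefficient: as a function of [x] the form is [q j * (x + c / q j)], so the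
     integral is the probability of a translated set. *)
  right; exists (q j), s; split => //.
    rewrite big_cons big_seq big1 ?addr0 1?mulrC// => i il.
    by rewrite ql// expr0n.
  move=> b y; set c := affine_form (upd y j 0).
  have -> : affine_form (fun i => if i \in j :: l then b i else y i) / q j =
     b j + c / q j.
    have -> : affine_form (fun i => if i \in j :: l then b i else y i) =
              affine_form (upd y j (b j)).
      congr (_ - _); apply: eq_bigr => i _; rewrite /upd inE.
      by case: eqP => [->//|_] /=; case: ifP => // /ql ->; rewrite !mul0r.
    by rewrite affine_form_upd -/c mulrDl [q j * _]mulrC mulfK// addrC.
  rewrite normal_prob_shift//; last exact: measurable_scale_preimage.
  set B := [set x : R | _].
  have mB : measurable B.
    have : measurable_fun setT (fun x : R => x + c / q j).
      exact: measurable_funD.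
    by move=> /(_ measurableT _ (measurable_scale_preimage (q j))); rewrite setTI.
  rewrite -[X in normal_prob _ _ X]setIT -integral_indic//.
  rewrite -Rintegral_normal_prob_affine//; last 2 first.
  - exact/measurable_EFinP/measurable_indic.
  - by move=> x; rewrite !lee_fin indicE; case: (_ \in _); rewrite ?lexx ler01.
  apply: eq_Rintegral => x _; rewrite gl /F affine_form_upd sgnE -/c /= indicE.
  congr (1 - 2 * (nat_of_bool _)%:R); apply/idP/idP => [Px|].
    rewrite inE /B /= mulrDr mulrCA divff// mulr1 addrC//.
  by rewrite inE /B /= mulrDr mulrCA divff// mulr1 addrC.
- right; have tn0 : t != 0 by rewrite gt_eqF.
  (* The mean of the inner Gaussian moves by [q j / a * x] with [x] of variance [s ^+ 2], so the
     variances add. *)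
  exists a, (Num.sqrt (t ^+ 2 + (q j / a) ^+ 2 * s ^+ 2)).
  have D0 : 0 < t ^+ 2 + (q j / a) ^+ 2 * s ^+ 2.
    by rewrite ltr_pwDl ?exprn_gt0// mulr_ge0// sqr_ge0.
  split; first exact: a0.
  - by rewrite sqrtr_gt0.
  - rewrite sqr_sqrtr ?ltW// mulrDl ta big_cons.
    by field.
  - move=> b y; set c := affine_form (upd (fun i => if i \in l then b i else y i) j 0).
    have formE x : affine_form (fun i => if i \in l then b i else upd y j x i) =
       c + q j * x.
      rewrite /c -affine_form_upd; congr (_ - _); apply: eq_bigr => i _; rewrite /upd.
      by case: eqP => // ->; rewrite (negbTE jl).
    have -> : affine_form (fun i => if i \in j :: l then b i else y i) / a =
       c / a + q j / a * b j.
      have -> : affine_form (fun i => if i \in j :: l then b i else y i) =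
         affine_form (upd (fun i => if i \in l then b i else y i) j (b j)).
        congr (_ - _); apply: eq_bigr => i _; rewrite /upd inE.
        by case: eqP => // ->.
      by rewrite affine_form_upd -/c mulrDl mulrAC.
    rewrite -normal_prob_convolution//; last exact: measurable_scale_preimage.
    rewrite -Rintegral_normal_prob_affine//; last 2 first.
    + by apply: measurable_normal_prob_affine => //; exact: measurable_scale_preimage.
    + move=> x; rewrite measure_ge0 probability_le1//.
      exact: measurable_scale_preimage.
    apply: eq_Rintegral => x _; rewrite gl formE.
    by rewrite [(c + q j * x) / a]mulrDl [q j * x / a]mulrAC.
Qed.

End gauss_exp_threshold.

(** * Second-order bounds for smoothed atoms *)

Section second_order_bounds.
Context {R : realType}.
Implicit Types (F f : R -> R) (x y h M K : R).

Lemma derivative_bound_lipschitz F f K x y :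
  (forall z, is_derive (z : R) (1 : R) F (f z)) -> (forall z, `|f z| <= K) ->
  `|F y - F x| <= K * `|y - x|.
Proof.
move=> dF fK; wlog xy : x y / x < y.
  move=> H; have [|yx|->] := ltgtP x y; first exact: H.
    by rewrite distrC (distrC y); exact: H.
  by rewrite !subrr !normr0 mulr0.
have cF : {within `[x, y], continuous F}.
  by apply: derivable_within_continuous => z _; exact: ex_derive.
have [c _ ->] := MVT xy (fun z _ => dF z) cF.
by rewrite normrM ler_wpM2r.
Qed.

(** Subtracting the linear term and the extremal quadratic leaves [g], whose derivative is
    nonpositive to the right of [x]. *)
Let taylor_upper F f M x h : (forall z, is_derive (z : R) (1 : R) F (f z)) ->
  (forall y z, `|f y - f z| <= M * `|y - z|) -> 0 < h ->
  F (x + h) - F x - h * f x <= M / 2 * h ^+ 2.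
Proof.
move=> dF fM h0.
pose g y := F y - f x * y - M / 2 * (y - x) ^+ 2.
have dg z : is_derive (z : R) (1 : R) g (f z - f x - M * (z - x)).
  rewrite /g; apply: is_derive_eq.
  by rewrite /GRing.scale /=; field.
have xh : x < x + h by rewrite ltrDl.
have cg : {within `[x, x + h], continuous g}.
  by apply: derivable_within_continuous => z _; exact: ex_derive.
have [c] := MVT xh (fun z _ => dg z) cg.
rewrite in_itv/= => /andP[xc _] gE.
have : g (x + h) - g x <= 0.
  rewrite gE (addrC x h) addrK pmulr_lle0// subr_le0 (le_trans (ler_norm _))//.
  by rewrite (le_trans (fM _ _))// gtr0_norm// subr_gt0.
rewrite /g; lra.
Qed.

(** The one-sided estimate is applied to [F] and [- F] when [h > 0], and to their reflections
    [y |-> - F (- y)] and [y |-> F (- y)] when [h < 0]. *)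
Lemma taylor2_bound F f M x h : (forall z, is_derive (z : R) (1 : R) F (f z)) ->
  (forall y z, `|f y - f z| <= M * `|y - z|) ->
  `|F (x + h) - F x - h * f x| <= M / 2 * h ^+ 2.
Proof.
move=> dF fM.
have dFN z : is_derive (z : R) (1 : R) (- F : R -> R) ((- f : R -> R) z).
  exact: is_deriveN.
have fMN y z : `|(- f : R -> R) y - (- f : R -> R) z| <= M * `|y - z|.
  by rewrite -opprD normrN; exact: fM.
have dFr (G g : R -> R) z : (forall z, is_derive (z : R) (1 : R) G (g z)) ->
    is_derive (z : R) (1 : R) (fun y => - G (- y)) (g (- z)).
  move=> dG; have dGz := dG (- z).
  have dO : is_derive z (1:R) (fun y : R => - y) (-1).
    by apply: is_derive_eq.
  have := is_derive1_comp dGz dO.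
  move=> H; apply: is_derive_eq (is_deriveN H) _.
  by rewrite mulrN mulr1 opprK.
have fMr (g : R -> R) : (forall y z, `|g y - g z| <= M * `|y - z|) ->
   forall y z, `|g (- y) - g (- z)| <= M * `|y - z|.
  by move=> gM y z; rewrite (le_trans (gM _ _))// -opprD normrN.
have [h0|h0|->] := ltgtP h 0; last first.
- by rewrite addr0 subrr mul0r subr0 normr0 expr0n mulr0.
- rewrite ler_norml; have := taylor_upper _ _ _ x _ dF fM h0.
  have := taylor_upper _ _ _ x _ dFN fMN h0.
  rewrite -![(- F : R -> R) _]/(- F _) -![(- f : R -> R) _]/(- f _).
  by move=> ? ?; apply/andP; split; lra.
- have nh : 0 < - h by rewrite oppr_gt0.
  rewrite ler_norml.
  have := taylor_upper _ _ _ (- x) _ (fun z => dFr _ _ z dF) (fMr _ fM) nh.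
  have := taylor_upper _ _ _ (- x) _ (fun z => dFr _ _ z dFN) (fMr _ fMN) nh.
  rewrite -opprD !opprK.
  rewrite -![(- F : R -> R) _]/(- F _) -![(- f : R -> R) _]/(- f _).
  have -> : - (- x - h) = x + h by ring.
  by rewrite sqrrN => ? ?; apply/andP; split; lra.
Qed.

End second_order_bounds.

(** * The normal distribution function and its first two derivatives *)

Section normal_cdf.
Context {R : realType} (t : R).
Hypothesis t0 : 0 < t.
Local Notation mu := (@lebesgue_measure R).
Let tn0 : t != 0. Proof. by rewrite gt_eqF. Qed.

Definition normal_cdf (x : R) : R := fine (normal_prob 0 t `]-oo, x]).

Lemma is_derive_normal_cdf x : is_derive x (1 : R) normal_cdf (normal_pdf 0 t x).
Proof.
have xx1 : x < x + 1 by rewrite ltrDl.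
have ip : mu.-integrable `]-oo, (x + 1)%R] (EFin \o normal_pdf 0 t).
  by apply: integrableS (integrable_normal_pdf 0 t).
have [dF FE] := continuous_FTC1 xx1 ip (ltNyr _)
  (continuous_normal_pdf tn0 (x:=x)).
by split; [exact: dF|rewrite -derive1E; exact: FE].
Qed.

Lemma normal_pdf_le_peak x : `|normal_pdf 0 t x| <= normal_peak t.
Proof. by rewrite ger0_norm ?normal_pdf_ge0// normal_pdf_ub. Qed.

Lemma is_derive_normal_pdf x :
  is_derive x (1 : R) (normal_pdf 0 t) (- (x / t ^+ 2) * normal_pdf 0 t x).
Proof.
rewrite !normal_pdfE// /normal_fun.
apply: is_derive_eq.
by rewrite /GRing.scale /=; field.
Qed.

Lemma sqr_normal_peak : normal_peak t ^+ 2 = (2 * pi * t ^+ 2)^-1.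
Proof.
rewrite /normal_peak exprVn sqr_sqrtr; last first.
  by rewrite mulrn_wge0// mulr_ge0 ?sqr_ge0// pi_ge0.
by congr (_^-1); ring.
Qed.

(* The sharp constant is [sqrt (2 pi / e)]; the bounds [expR u >= 1 + u] and
   [pi <= 4] give [2]. *)
Lemma normal_pdf_deriv_le x :
  `|- (x / t ^+ 2) * normal_pdf 0 t x| <= 2 * normal_peak t ^+ 2.
Proof.
set p := normal_peak t; have p0 : 0 < p by exact: normal_peak_gt0.
have t2 : 0 < t ^+ 2 by rewrite exprn_gt0.
have p2 : 1 <= 8 * p ^+ 2 * t ^+ 2.
  rewrite sqr_normal_peak; have pi4 : (pi : R) <= 4.
    by have := pihalf_lt2 R; move: (pi : R) => w; lra.
  move: (pi : R) (pi_gt0 R) pi4 => w w0 w4.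
  have -> : 8 * (2 * w * t ^+ 2)^-1 * t ^+ 2 = 4 / w.
    by field; rewrite tn0 gt_eqF.
  by rewrite ler_pdivlMr// mul1r.
have e1 : expR (- (x - 0) ^+ 2 / (t ^+ 2 *+ 2)) * (2 * t ^+ 2 + x ^+ 2) <= 2 * t ^+ 2.
  rewrite subr0 mulNr expRN mulrC ler_pdivrMr ?expR_gt0//.
  have := expR_ge1Dx (x ^+ 2 / (t ^+ 2 *+ 2)).
  rewrite -(ler_pM2l (_ : 0 < 2 * t ^+ 2)) ?mulr_gt0//.
  move=> /(le_trans _); apply.
  by rewrite le_eqVlt; apply/orP; left; apply/eqP; field.
(* After squaring, this is the arithmetic-geometric mean inequality [8 * t ^+ 2 * x ^+ 2 <= (2 * t
   ^+ 2 + x ^+ 2) ^+ 2] combined with [p2]. *)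
have x1 : `|x| <= p * (2 * t ^+ 2 + x ^+ 2).
  rewrite -(@ler_pXn2r _ 2)// ?nnegrE ?normr_ge0//; last first.
    by rewrite mulr_ge0 ?(ltW p0)// addr_ge0 ?sqr_ge0// mulr_ge0// ltW.
  rewrite real_normK ?num_real// exprMn.
  have : x ^+ 2 <= 8 * p ^+ 2 * t ^+ 2 * x ^+ 2.
    by rewrite ler_peMl// sqr_ge0.
  move=> /le_trans; apply.
  have := mulr_ge0 (sqr_ge0 p) (sqr_ge0 (2 * t ^+ 2 - x ^+ 2)).
  by rewrite -subr_ge0; lra.
rewrite normrM normrN normrM normrV ?unitfE ?gt_eqF// (gtr0_norm t2).
rewrite (ger0_norm (normal_pdf_ge0 _ _ _)) normal_pdfE// /normal_fun -/p.
set E := expR _ in e1 *; have E0 : 0 < E by exact: expR_gt0.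
rewrite mulrAC ler_pdivrMr//.
have : `|x| * (p * E) <= p * (2 * t ^+ 2 + x ^+ 2) * (p * E).
  by rewrite ler_wpM2r// mulr_ge0// ltW.
have : p ^+ 2 * (E * (2 * t ^+ 2 + x ^+ 2)) <= p ^+ 2 * (2 * t ^+ 2).
  by rewrite ler_wpM2l// sqr_ge0.
by lra.
Qed.

Lemma normal_cdf_lipschitz x y :
  `|normal_cdf y - normal_cdf x| <= normal_peak t * `|y - x|.
Proof.
exact: derivative_bound_lipschitz is_derive_normal_cdf normal_pdf_le_peak.
Qed.

Lemma normal_cdf_taylor2 x h :
  `|normal_cdf (x + h) - normal_cdf x - h * normal_pdf 0 t x| <=
  normal_peak t ^+ 2 * h ^+ 2.
Proof.
have pM y z : `|normal_pdf 0 t y - normal_pdf 0 t z| <=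
    2 * normal_peak t ^+ 2 * `|y - z|.
  exact: derivative_bound_lipschitz is_derive_normal_pdf normal_pdf_deriv_le.
have := taylor2_bound _ _ _ x h is_derive_normal_cdf pM.
by rewrite (_ : 2 * _ / 2 = normal_peak t ^+ 2)//; field.
Qed.

Lemma normal_prob_le0 v : normal_prob v t `]-oo, 0] = normal_prob 0 t `]-oo, - v].
Proof.
rewrite -{1}[v]add0r normal_prob_shift//; congr (normal_prob _ _ _).
by apply/seteqP; split => x /=; rewrite !in_itv/= lerNr -subr_ge0; lra.
Qed.

Lemma normal_prob_lt0 v : normal_prob v t `]-oo, 0[ = normal_prob v t `]-oo, 0].
Proof.
rewrite /normal_prob integral_itv_bndo_bndc//.
by apply/measurable_EFinP/measurable_funTS; exact: measurable_normal_pdf.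
Qed.

Lemma fine_normal_probC v (A : set R) : measurable A ->
  fine (normal_prob v t (~` A)) = 1 - fine (normal_prob v t A).
Proof.
move=> mA; rewrite [X in fine X = _](probability_setC (normal_prob v t) mA).
rewrite fineB// ?fin_num_measure//.
Qed.

(* With [p] the probability of [x <= 0], this probability is one of
   [p], [1 - p], [0]. *)
Lemma fine_normal_prob_cone (a : R) (r : arel) : a != 0 ->
  exists e c : R, `|e| <= 1 /\ forall v,
    fine (normal_prob v t [set x | match r with
      | RLt => a * x < 0 | RLe => a * x <= 0 | REq => a * x == 0
      | RGe => 0 <= a * x | RGt => 0 < a * x end]) = c + e * normal_cdf (- v).
Proof.
move=> a0.
have lt0 : exists e c : R, `|e| <= 1 /\ forall v,
  fine (normal_prob v t `]-oo, 0[) = c + e * normal_cdf (- v).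
  exists 1, 0; split; first by rewrite normr1.
  by move=> v; rewrite add0r mul1r normal_prob_lt0 normal_prob_le0.
have le0 : exists e c : R, `|e| <= 1 /\ forall v,
  fine (normal_prob v t `]-oo, 0]) = c + e * normal_cdf (- v).
  exists 1, 0; split; first by rewrite normr1.
  by move=> v; rewrite add0r mul1r normal_prob_le0.
have eq0 : exists e c : R, `|e| <= 1 /\ forall v,
  fine (normal_prob v t [set 0]) = c + e * normal_cdf (- v).
  exists 0, 0; split; first by rewrite normr0.
  by move=> v; rewrite add0r mul0r /normal_prob integral_set1.
have ge0 : exists e c : R, `|e| <= 1 /\ forall v,
  fine (normal_prob v t `[0, +oo[) = c + e * normal_cdf (- v).
  exists (-1), 1; split; first by rewrite normrN normr1.
  move=> v; rewrite -setCitvl fine_normal_probC// normal_prob_lt0.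
  by rewrite normal_prob_le0 mulN1r.
have gt0 : exists e c : R, `|e| <= 1 /\ forall v,
  fine (normal_prob v t `]0, +oo[) = c + e * normal_cdf (- v).
  exists (-1), 1; split; first by rewrite normrN normr1.
  move=> v; rewrite -setCitvl fine_normal_probC//.
  by rewrite normal_prob_le0 mulN1r.
have Eeq : [set x | a * x == 0] = [set 0].
  apply/seteqP; split => x /=; first by rewrite mulf_eq0 (negbTE a0) => /eqP.
  by move=> ->; rewrite mulr0.
case: (ltgtP a 0) a0 => // a0 _; case: r; rewrite ?Eeq//.
- rewrite (_ : [set x | _] = `]0, +oo[%classic)//.
  by apply/seteqP; split => x /=; rewrite in_itv/= andbT nmulr_rlt0.
- rewrite (_ : [set x | _] = `[0, +oo[%classic)//.
  by apply/seteqP; split => x /=; rewrite in_itv/= andbT nmulr_rle0.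
- rewrite (_ : [set x | _] = `]-oo, 0]%classic)//.
  by apply/seteqP; split => x /=; rewrite in_itv/= nmulr_rge0.
- rewrite (_ : [set x | _] = `]-oo, 0[%classic)//.
  by apply/seteqP; split => x /=; rewrite in_itv/= nmulr_rgt0.
- rewrite (_ : [set x | _] = `]-oo, 0[%classic)//.
  by apply/seteqP; split => x /=; rewrite in_itv/= pmulr_rlt0.
- rewrite (_ : [set x | _] = `]-oo, 0]%classic)//.
  by apply/seteqP; split => x /=; rewrite in_itv/= pmulr_rle0.
- rewrite (_ : [set x | _] = `[0, +oo[%classic)//.
  by apply/seteqP; split => x /=; rewrite in_itv/= andbT pmulr_rge0.
- rewrite (_ : [set x | _] = `]0, +oo[%classic)//.
  by apply/seteqP; split => x /=; rewrite in_itv/= andbT pmulr_rgt0.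
Qed.

End normal_cdf.

(** * Lipschitz and linearization bounds for [dsmooth] *)

Section dsmooth_bounds.
Context {R : realType} {m k : nat}.
Variables (q : 'I_k -> 'I_m -> R) (q0 : 'I_k -> R) (rl : 'I_k -> arel).
Variables (sigma : R) (i : 'I_k).
Hypothesis sigma0 : 0 < sigma.
Hypothesis qi0 : exists j, q i j != 0.

Let P (s : R) : bool := match rl i with
  | RLt => s < 0 | RLe => s <= 0 | REq => s == 0 | RGe => 0 <= s | RGt => 0 < s
  end.

Let mP : measurable [set x | P x].
Proof.
rewrite /P; case: (rl i).
- have -> : [set x : R | x < 0] = `]-oo, 0[%classic.
    by apply/seteqP; split => x /=; rewrite in_itv.
  exact: measurable_itv.
- have -> : [set x : R | x <= 0] = `]-oo, 0]%classic.
    by apply/seteqP; split => x /=; rewrite in_itv.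
  exact: measurable_itv.
- have -> : [set x : R | x == 0] = [set 0].
    by apply/seteqP; split => x /= /eqP.
  exact: measurable_set1.
- have -> : [set x : R | 0 <= x] = `[0, +oo[%classic.
    by apply/seteqP; split => x /=; rewrite in_itv/= andbT.
  exact: measurable_itv.
- have -> : [set x : R | 0 < x] = `]0, +oo[%classic.
    by apply/seteqP; split => x /=; rewrite in_itv/= andbT.
  exact: measurable_itv.
Qed.

(** A nonzero coefficient excludes the degenerate case of [gauss_iter_threshold], and all
    coordinates are integrated out, so the default value 0 disappears. *)
Lemma dsmooth_normal_probE : exists a t : R,
  [/\ a != 0, 0 < t, t ^+ 2 * a ^+ 2 = sigma ^+ 2 * \sum_j q i j ^+ 2
    & forall b, dsmooth q q0 rl sigma i b = 1 - 2 *
      fine (normal_prob (affine_form (q i) (q0 i) b / a) t [set x | P (a * x)])].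
Proof.
have [[q_eq0 _]|[a [t [a0 t0 ta dE]]]] := gauss_iter_threshold (q i) (q0 i) P mP
  sigma (enum 'I_m) sigma0 (enum_uniq _).
  by have [j /negP[]] := qi0; rewrite q_eq0 ?mem_enum.
exists a, t; split; [exact: a0|exact: t0| |].
  by rewrite ta big_enum.
move=> b; apply: etrans (dE b (fun=> 0)) _.
have -> // : (fun j => if j \in enum 'I_m then b j else 0) = b.
by apply/funext => j; rewrite mem_enum.
Qed.

Lemma dsmooth_le1 b : `|dsmooth q q0 rl sigma i b| <= 1.
Proof.
have [a [t [a0 t0 _ ->]]] := dsmooth_normal_probE.
set A := [set x | _]; set v := affine_form _ _ _ / a.
have mA : measurable A by exact: measurable_scale_preimage.
have p0 : (0 <= normal_prob v t A)%E by exact: measure_ge0.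
have p1 : (normal_prob v t A <= 1)%E by exact: probability_le1.
have fp : normal_prob v t A \is a fin_num.
  by rewrite ge0_fin_numE// (le_lt_trans p1)// ltry.
have := fine_ge0 p0; have : fine (normal_prob v t A) <= 1.
  by rewrite -lee_fin fineK.
by rewrite ler_norml => ? ?; apply/andP; split; lra.
Qed.

(* [gamma] is [beta * slope]. *)
Definition slope : R := Num.sqrt 2 / (Num.sqrt pi * sigma).

(** Up to a factor of size at most 2 and a constant, [dsmooth] is [normal_cdf] of a linear form that
    moves by [h]. With [p = normal_peak t], the increment is at most [2 * p * |h|] and the error at
    most [2 * p ^+ 2 * h ^+ 2], half the square of that bound. *)
Lemma dsmooth_taylor : exists D : ('I_m -> R) -> 'I_m -> R,
  forall b v : 'I_m -> R,
  let N := slope * \sum_(j | q i j != 0) `|v j| in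
  `|dsmooth q q0 rl sigma i (fun j => b j + v j) - dsmooth q q0 rl sigma i b| <= N /\
  `|dsmooth q q0 rl sigma i (fun j => b j + v j) - dsmooth q q0 rl sigma i b
    - \sum_j D b j * v j| <= N ^+ 2 / 2.
Proof.
have [a [t [a0 t0 ta dE]]] := dsmooth_normal_probE.
have [e [c [e1 pE]]] := fine_normal_prob_cone t t0 a (rl i) a0.
have {}dE b : dsmooth q q0 rl sigma i b =
    1 - 2 * (c + e * normal_cdf t (- (affine_form (q i) (q0 i) b / a))).
  rewrite dE -pE; congr (1 - 2 * fine _); congr (normal_prob _ _).
  by apply/seteqP; split => z /=; rewrite /P; case: (rl i).
pose x b := - (affine_form (q i) (q0 i) b / a).
exists (fun b j => 2 * e * normal_pdf 0 t (x b) * (q i j / a)) => b v N.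
pose S := \sum_j q i j * v j; pose h := - (S / a).
have xh : - (affine_form (q i) (q0 i) (fun j => b j + v j) / a) = x b + h.
  rewrite /x /h /affine_form /S; under eq_bigr do rewrite mulrDr.
  by rewrite big_split /=; field.
have DE : \sum_j 2 * e * normal_pdf 0 t (x b) * (q i j / a) * v j =
    - (2 * e * (h * normal_pdf 0 t (x b))).
  rewrite /h /S mulr_suml mulNr mulrN opprK mulr_suml mulr_sumr.
  by apply: eq_bigr => j _; field.
(* Each [|q i j|] is at most the Euclidean norm [Q] of the row. Since [t * |a| = sigma * Q], the
   norm cancels in [2 * normal_peak t * Q / |a|], which leaves exactly [slope]. *)
have hN : 2 * normal_peak t * `|h| <= N.
  pose Q := Num.sqrt (\sum_j q i j ^+ 2).
  have Q2 : Q ^+ 2 = \sum_j q i j ^+ 2.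
    by rewrite sqr_sqrtr// sumr_ge0// => j _; rewrite sqr_ge0.
  have hQ : `|h| <= Q / `|a| * \sum_(j | q i j != 0) `|v j|.
    rewrite /h normrN normrM normfV mulrAC ler_wpM2r ?invr_ge0//.
    rewrite (le_trans (ler_norm_sum _ _ _))// mulr_sumr.
    rewrite [leRHS]big_mkcond ler_sum// => j _; rewrite normrM.
    case: eqP => [->|_] /=; first by rewrite normr0 mul0r.
    rewrite ler_wpM2r// -(@ler_pXn2r _ 2)// ?nnegrE ?sqrtr_ge0//.
    rewrite Q2 real_normK ?num_real// (bigD1 j)//= lerDl.
    by rewrite sumr_ge0// => l _; rewrite sqr_ge0.
  have -> : N = 2 * normal_peak t * (Q / `|a|) * \sum_(j | q i j != 0) `|v j|.
    rewrite /N; congr (_ * _); apply/eqP.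
    have a_gt0 : 0 < `|a| by rewrite normr_gt0.
    have p_ge0 := normal_peak_ge0 t.
    have spi : 0 < Num.sqrt (pi : R) by rewrite sqrtr_gt0 pi_gt0.
    rewrite -(@eqrXn2 _ 2)//; last 2 first.
    - by rewrite /slope divr_ge0// mulr_ge0// ltW.
    - by rewrite !mulr_ge0// ?sqrtr_ge0// invr_ge0 ltW.
    have -> : (2 * normal_peak t * (Q / `|a|)) ^+ 2 =
        4 * normal_peak t ^+ 2 * Q ^+ 2 / `|a| ^+ 2.
      by field; rewrite gt_eqF.
    have -> : slope ^+ 2 = 2 / (pi * sigma ^+ 2).
      by rewrite /slope expr_div_n exprMn !sqr_sqrtr// pi_ge0.
    rewrite sqr_normal_peak// Q2 real_normK ?num_real//.
    have t2 : t ^+ 2 != 0 by rewrite expf_eq0 /= gt_eqF.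
    have -> : \sum_j q i j ^+ 2 = t ^+ 2 * a ^+ 2 / sigma ^+ 2.
      by rewrite ta mulrAC divff ?mul1r// expf_eq0/= gt_eqF.
    move: (pi : R) (pi_gt0 R) => w w0; apply/eqP; field.
    by rewrite a0 !gt_eqF.
  by rewrite -[leRHS]mulrA ler_wpM2l// mulr_ge0// normal_peak_ge0.
rewrite !dE xh -/(x b) DE; split.
  rewrite (_ : _ - _ = - (2 * e * (normal_cdf t (x b + h) - normal_cdf t (x b)))); last by ring.
  rewrite normrN normrM normrM ger0_norm//.
  apply: le_trans hN; rewrite -!mulrA ler_wpM2l//.
  have := normal_cdf_lipschitz t t0 (x b) (x b + h).
  rewrite addrAC subrr add0r => /(le_trans _); apply.
  by rewrite ler_piMl.
rewrite (_ : _ - _ - _ = - (2 * e * (normal_cdf t (x b + h) - normal_cdf t (x b)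
   - h * normal_pdf 0 t (x b)))); last by ring.
rewrite normrN normrM normrM ger0_norm//.
have H := normal_cdf_taylor2 t t0 (x b) h.
apply: (@le_trans _ _ (2 * (normal_peak t ^+ 2 * h ^+ 2))).
  rewrite -mulrA ler_wpM2l//; apply: le_trans H.
  by rewrite ler_piMl.
have : (2 * normal_peak t * `|h|) ^+ 2 <= N ^+ 2.
  by rewrite ler_pXn2r// nnegrE ?(le_trans _ hN)// !mulr_ge0 ?normal_peak_ge0.
rewrite 2!exprMn real_normK ?num_real//; lra.
Qed.

End dsmooth_bounds.

(** * Multiaffine functions *)

Section multiaffine.
Context {R : realFieldType} {I : eqType}.
Implicit Types (F : (I -> R) -> R) (r s : I -> R) (i : I) (l : seq I).

Definition set_coord r i (t : R) : I -> R := fun i' => if i' == i then t else r i'.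

Definition affine (g : R -> R) := forall t, g t = g 0 + t * (g 1 - g 0).

Definition multiaffine F := forall r i, affine (fun t => F (set_coord r i t)).

Definition bounded1 F := forall r, (forall i, `|r i| <= 1) -> `|F r| <= 1.

(** For a multiaffine [F] this unit difference is the exact partial derivative. *)
Definition partial i F r : R := F (set_coord r i 1) - F (set_coord r i 0).

(** Lets the passage from [r] to [s] be telescoped one coordinate at a time. *)
Definition hybrid r s l : I -> R := fun i => if i \in l then s i else r i.

Lemma set_coordC r i j t u : i != j ->
  set_coord (set_coord r i t) j u = set_coord (set_coord r j u) i t.
Proof.
move=> ij; apply/funext => z; rewrite /set_coord.
by case: (eqVneq z j) => // ->; rewrite eq_sym (negbTE ij).
Qed.

Lemma set_coord_set r i t u : set_coord (set_coord r i t) i u = set_coord r i u.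
Proof. by apply/funext => z; rewrite /set_coord; case: eqP. Qed.

Lemma set_coord_cube r i t : (forall i, `|r i| <= 1) -> `|t| <= 1 ->
  forall j, `|set_coord r i t j| <= 1.
Proof. by move=> r1 t1 j; rewrite /set_coord; case: ifP. Qed.

Lemma hybrid_cube r s l : (forall i, `|r i| <= 1) -> (forall i, `|s i| <= 1) ->
  forall i, `|hybrid r s l i| <= 1.
Proof. by move=> r1 s1 i; rewrite /hybrid; case: ifP. Qed.

Lemma hybrid_cons r s i l : i \notin l ->
  hybrid r s (i :: l) = set_coord (hybrid r s l) i (s i) /\
  hybrid r s l = set_coord (hybrid r s l) i (r i).
Proof.
move=> il; split; apply/funext => j; rewrite /set_coord /hybrid ?inE.
  by case: eqP => // ->.
by case: eqP => // ->; rewrite (negbTE il).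
Qed.

Lemma multiaffine_partial i F : multiaffine F -> multiaffine (partial i F).
Proof.
move=> mF r j t; rewrite /partial.
case: (eqVneq j i) => [->|ji]; first by rewrite !set_coord_set; ring.
rewrite !(set_coordC _ _ _ _ _ ji).
by rewrite (mF (set_coord r i 1) j t) (mF (set_coord r i 0) j t); ring.
Qed.

Lemma multiaffine_diff F r i t u : multiaffine F ->
  F (set_coord r i t) - F (set_coord r i u) = (t - u) * partial i F r.
Proof. by move=> mF; rewrite (mF r i t) (mF r i u) /partial; ring. Qed.

(** By affinity the partial derivative is half the difference of the values at coordinate 1 and
    coordinate -1, both of which lie in the interval from -1 to 1. *)
Lemma bounded1_partial i F : multiaffine F -> bounded1 F ->
  bounded1 (partial i F).
Proof.
move=> mF bF r r1.
have := multiaffine_diff F r i 1 (-1) mF.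
have := bF _ (set_coord_cube r i 1 r1 _); rewrite normr1 lexx => /(_ isT).
have := bF _ (set_coord_cube r i (-1) r1 _); rewrite normrN normr1 lexx => /(_ isT).
by rewrite !ler_norml => /andP[? ?] /andP[? ?] ?; apply/andP; split; lra.
Qed.

Lemma multiaffine_lipschitz F r s l : multiaffine F -> bounded1 F ->
  (forall i, `|r i| <= 1) -> (forall i, `|s i| <= 1) -> uniq l ->
  `|F (hybrid r s l) - F r| <= \sum_(i <- l) `|s i - r i|.
Proof.
move=> mF bF r1 s1; elim: l => [|i l IH] /=.
  rewrite big_nil (_ : hybrid r s [::] = r) ?subrr ?normr0//.
case/andP => il /IH {}IH; rewrite big_cons.
have [-> e2] := hybrid_cons r s i l il.
have -> : F (set_coord (hybrid r s l) i (s i)) - F r =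
    (s i - r i) * partial i F (hybrid r s l) + (F (hybrid r s l) - F r).
  by rewrite -multiaffine_diff// -e2; ring.
apply: le_trans (ler_normD _ _) _; apply: lerD => //.
rewrite normrM ler_piMr//; apply: bounded1_partial => //; exact: hybrid_cube.
Qed.

(** Switching one more coordinate [i] adds a cross term, at most [rho i * T] because the partial
    derivative is itself multiaffine and bounded, and a linearization error, at most
    [rho i ^+ 2 / 2]. Together with [T ^+ 2 / 2] these complete the square of [rho i + T]. *)
Lemma multiaffine_taylor F r s l (D rho : I -> R) :
  multiaffine F -> bounded1 F ->
  (forall i, `|r i| <= 1) -> (forall i, `|s i| <= 1) -> uniq l ->
  (forall i, `|s i - r i| <= rho i) ->
  (forall i, `|s i - r i - D i| <= rho i ^+ 2 / 2) ->
  `|F (hybrid r s l) - F r - \sum_(i <- l) D i * partial i F r| <=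
  (\sum_(i <- l) rho i) ^+ 2 / 2.
Proof.
move=> mF bF r1 s1 + rho1 rho2; elim: l => [|i l IH] /=.
  by rewrite !big_nil (_ : hybrid r s [::] = r)// !subrr normr0 expr0n mul0r.
case/andP => il ul; have {}IH := IH ul; rewrite !big_cons.
have [-> e2] := hybrid_cons r s i l il.
set S := \sum_(j <- l) D j * _ in IH *; set T := \sum_(j <- l) rho j in IH *.
have T0 : 0 <= T.
  by rewrite sumr_ge0// => j _; exact: le_trans (rho1 j).
have -> : F (set_coord (hybrid r s l) i (s i)) - F r - (D i * partial i F r + S) =
    (s i - r i) * (partial i F (hybrid r s l) - partial i F r) +
    (s i - r i - D i) * partial i F r + (F (hybrid r s l) - F r - S).
  have := multiaffine_diff F (hybrid r s l) i (s i) (r i) mF.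
  by rewrite -e2 => E; lra.
have H1 : `|(s i - r i) * (partial i F (hybrid r s l) - partial i F r)| <= rho i * T.
  rewrite normrM ler_pM//.
  apply: (le_trans (multiaffine_lipschitz (partial i F) r s l _ _ r1 s1 ul)).
  - exact: multiaffine_partial.
  - exact: bounded1_partial.
  - exact: ler_sum.
have H2 : `|(s i - r i - D i) * partial i F r| <= rho i ^+ 2 / 2.
  by rewrite normrM -[leRHS]mulr1 ler_pM//; apply: bounded1_partial.
apply: le_trans (ler_normD _ _) _.
apply: (@le_trans _ _ (rho i * T + rho i ^+ 2 / 2 + T ^+ 2 / 2)); last by lra.
by apply: lerD => //; apply: le_trans (ler_normD _ _) _; apply: lerD.
Qed.

End multiaffine.

(** * Fourier sums of Boolean constraints *)

Section fourier_expansion.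
Context {R : realType} {n k nc : nat}.
Variable phi : 'I_nc -> {ffun 'I_n -> bool} -> {ffun 'I_k -> bool} -> bool.
Variable c : 'I_nc.

(** Propositional variables and atoms share one index type, so that the multiaffine estimates treat
    both alike. *)
Definition fourier_sum (r : 'I_n + 'I_k -> R) : R :=
  \sum_(S : {set 'I_n}) \sum_(T : {set 'I_k})
    (fourier phi c S T * \prod_(i in S) r (inl i) * \prod_(i in T) r (inr i)).

(** Injectivity of [f] makes coordinate [i] occur in at most one factor. *)
Lemma affine_prod_set_coord (I J : finType) (f : J -> I) (A : {set J})
    (r : I -> R) i : injective f ->
  affine (fun t => \prod_(j in A) set_coord r i t (f j)).
Proof.
move=> finj t; have [/existsP[j /andP[jA /eqP fj]]|/existsPn nA] :=
  boolP [exists j, (j \in A) && (f j == i)].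
  have E u : \prod_(j in A) set_coord r i u (f j) =
      u * \prod_(j' in A | j' != j) r (f j').
    rewrite (bigD1 j)//= {1}/set_coord fj eqxx; congr (_ * _).
    apply: eq_bigr => j' /andP[_ j'j]; rewrite /set_coord.
    by rewrite -fj (inj_eq finj) (negbTE j'j).
  by rewrite !E; ring.
have E u : \prod_(j in A) set_coord r i u (f j) = \prod_(j in A) r (f j).
  apply: eq_bigr => j jA; rewrite /set_coord.
  by have := nA j; rewrite jA /= => /negbTE ->.
by rewrite !E; ring.
Qed.

Lemma fourier_sum_multiaffine : multiaffine fourier_sum.
Proof.
move=> r i t; rewrite /fourier_sum -sumrB mulr_sumr -big_split /=.
apply: eq_bigr => S _; rewrite -sumrB mulr_sumr -big_split /=.
apply: eq_bigr => T _.
have inl_inj : injective (@inl 'I_n 'I_k) by move=> ? ? [].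
have inr_inj : injective (@inr 'I_n 'I_k) by move=> ? ? [].
case: i => i.
  have E u : \prod_(j in T) set_coord r (inl i) u (inr j) = \prod_(j in T) r (inr j).
    by apply: eq_bigr.
  by rewrite !E (affine_prod_set_coord _ _ _ S r (inl i) inl_inj t); ring.
have E u : \prod_(j in S) set_coord r (inr i) u (inl j) = \prod_(j in S) r (inl j).
  by apply: eq_bigr.
by rewrite !E (affine_prod_set_coord _ _ _ T r (inr i) inr_inj t); ring.
Qed.

Lemma sum_subset_prod (I : finType) (f g : I -> R) :
  \sum_(S : {set I}) (\prod_(i in S) f i) * (\prod_(i in S) g i) =
  \prod_i (1 + f i * g i).
Proof.
under [RHS]eq_bigr do rewrite addrC.
rewrite bigA_distr; apply: eq_bigr => S _.
by rewrite -big_split /= [LHS]big_mkcond.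
Qed.

(** Summing over [S] and [T] first factors the expansion. For [r] in the cube the result is the mean
    of the constraint under independent signs with means [r], each factor divided by 2 being a
    probability. *)
Lemma fourier_sumE r : fourier_sum r = ((2 : R) ^+ (n + k))^-1 *
  \sum_(x : {ffun 'I_n -> bool}) \sum_(z : {ffun 'I_k -> bool})
    (sgn (phi c x z) * \prod_i (1 + sgn (x i) * r (inl i)) *
     \prod_i (1 + sgn (z i) * r (inr i))).
Proof.
set K := _^-1.
have H S T : fourier phi c S T * \prod_(i in S) r (inl i) * \prod_(i in T) r (inr i) =
    \sum_x \sum_z K * (sgn (phi c x z) *
      ((\prod_(i in S) sgn (x i) * \prod_(i in S) r (inl i)) *
       (\prod_(i in T) sgn (z i) * \prod_(i in T) r (inr i)))).
  rewrite /fourier -/K mulr_sumr !mulr_suml; apply: eq_bigr => x _.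
  by rewrite mulr_sumr !mulr_suml; apply: eq_bigr => z _; ring.
transitivity (\sum_(S : {set 'I_n}) \sum_(T : {set 'I_k}) \sum_x \sum_z K * (sgn (phi c x z) *
      ((\prod_(i in S) sgn (x i) * \prod_(i in S) r (inl i)) *
       (\prod_(i in T) sgn (z i) * \prod_(i in T) r (inr i))))).
  by apply: eq_bigr => S _; apply: eq_bigr => T _; exact: H.
under eq_bigr => S _ do rewrite exchange_big /=.
rewrite exchange_big /= mulr_sumr; apply: eq_bigr => x _.
under eq_bigr => S _ do rewrite exchange_big /=.
rewrite exchange_big /= mulr_sumr; apply: eq_bigr => z _.
rewrite -!sum_subset_prod -mulrA big_distrl /= !mulr_sumr; apply: eq_bigr => S _.
by rewrite !mulr_sumr; apply: eq_bigr => T _.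
Qed.

Lemma sum_prod_sgn (J : finType) (f : J -> R) :
  \sum_(x : {ffun J -> bool}) \prod_i (1 + sgn (x i) * f i) = 2 ^+ #|J|.
Proof.
rewrite -(bigA_distr_bigA (fun i (b : bool) => 1 + sgn b * f i)) /=.
rewrite -prodr_const; apply: eq_bigr => i _.
by rewrite big_bool /sgn /=; ring.
Qed.

(** On the cube the weights in [fourier_sumE] are nonnegative with total mass [2 ^+ (n + k)], so the
    value is an average of signs. *)
Lemma fourier_sum_bounded1 : bounded1 fourier_sum.
Proof.
move=> r r1; rewrite fourier_sumE.
have K0 : 0 < (2 : R) ^+ (n + k) by rewrite exprn_gt0.
have w0 (b : bool) (t : R) : `|t| <= 1 -> 0 <= 1 + sgn b * t.
  by rewrite ler_norml /sgn => /andP[? ?]; case: b; lra.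
rewrite normrM normfV (gtr0_norm K0) ler_pdivrMl// mulr1.
apply: (@le_trans _ _ (\sum_(x : {ffun 'I_n -> bool}) \sum_(z : {ffun 'I_k -> bool})
    (\prod_i (1 + sgn (x i) * r (inl i)) *
     \prod_i (1 + sgn (z i) * r (inr i))))).
  apply: le_trans (ler_norm_sum _ _ _) _; apply: ler_sum => x _.
  apply: le_trans (ler_norm_sum _ _ _) _; apply: ler_sum => z _.
  rewrite !normrM (_ : `|sgn _| = 1) ?mul1r; last first.
    by rewrite /sgn; case: ifP; rewrite ?normrN normr1.
  by rewrite !ger0_norm// prodr_ge0// => i _; exact: w0.
under eq_bigr do rewrite -mulr_sumr sum_prod_sgn.
by rewrite -mulr_suml sum_prod_sgn !card_ord exprD.
Qed.

Variable A : {set 'I_k}.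
Hypothesis phiA : forall x (z z' : {ffun 'I_k -> bool}),
  (forall i, i \in A -> z i = z' i) -> phi c x z = phi c x z'.

(* Flipping the truth value of an irrelevant atom [i] negates the summands. *)
Lemma fourier_irrelevant S (T : {set 'I_k}) i : i \in T -> i \notin A -> fourier phi c S T = 0 :> R.
Proof.
move=> iT iA; rewrite /fourier big1 ?mulr0// => x _.
pose flip (z : {ffun 'I_k -> bool}) := [ffun j => if j == i then ~~ z j else z j].
have flipK : involutive flip.
  by move=> z; apply/ffunP => j; rewrite !ffunE; case: eqP; rewrite ?negbK.
pose G (z : {ffun 'I_k -> bool}) : R :=
  sgn (phi c x z) * \prod_(j in S) sgn (x j) * \prod_(j in T) sgn (z j).
rewrite -/(\sum_z G z).
have GN z : G (flip z) = - G z.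
  rewrite /G (phiA x (flip z) z); last first.
    move=> j jA; rewrite ffunE; case: eqP => // ji.
    by move: iA; rewrite -ji jA.
  rewrite [in LHS](bigD1 i)//= [in RHS](bigD1 i)//= !ffunE eqxx.
  have -> : \prod_(j in T | j != i) sgn (flip z j) =
            \prod_(j in T | j != i) sgn (z j) :> R.
    by apply: eq_bigr => j /andP[_ /negbTE ji]; rewrite ffunE ji.
  by rewrite /sgn; case: (z i) => /=; ring.
have : \sum_z G z = - \sum_z G z.
  rewrite {1}(reindex_inj (inv_inj flipK)) /= -sumrN.
  by apply: eq_bigr => z _; exact: GN.
by move/eqP; rewrite -addr_eq0 -mulr2n mulrn_eq0 /= => /eqP.
Qed.

(** Only the terms with [T \subset A] survive. This confines the later estimates to the atoms of the
    constraint, where [beta] applies. *)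
Lemma fourier_sum_relevant (r s : 'I_n + 'I_k -> R) :
  (forall i, r (inl i) = s (inl i)) -> (forall i, i \in A -> r (inr i) = s (inr i)) ->
  fourier_sum r = fourier_sum s.
Proof.
move=> rsl rsr; apply: eq_bigr => S _; apply: eq_bigr => T _.
have [TA|/subsetPn[i iT iA]] := boolP (T \subset A); last first.
  by rewrite (fourier_irrelevant _ _ i iT iA) !mul0r.
congr (_ * _ * _); apply: eq_bigr => i iT //.
by apply: rsr; exact: (fintype.subsetP TA).
Qed.

End fourier_expansion.

(** * The smoothed objective and projected gradient descent *)

Lemma derive1_quadratic_error {R : realType} (f : R -> R) (x g M : R) :
  (forall h, `|f (x + h) - f x - h * g| <= M * h ^+ 2) -> derive1 f x = g.
Proof.
move=> fM; apply/cvg_lim => //; apply/cvgrPdist_le => e e0.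
have M0 : 0 <= M.
  by have := fM 1; rewrite expr1n mulr1; apply: le_trans.
near=> h.
have h0 : h != 0 by near: h; exact: nbhs_dnbhs_neq.
(* The added 1 keeps the denominator positive when [M = 0]. *)
have he : `|h| <= e / (M + 1).
  near: h; apply: dnbhs0_le; rewrite divr_gt0// ltr_wpDl//.
rewrite /GRing.scale /= -(@ler_pM2l _ `|h|) ?normr_gt0// -normrM.
have -> : h * (g - h^-1 * (f (h + x) - f x)) = - (f (x + h) - f x - h * g).
  by rewrite addrC (addrC h); field.
rewrite normrN; apply: le_trans (fM h) _.
rewrite -(real_normK (num_real h)) expr2 mulrCA ler_wpM2l//.
move: he; rewrite ler_pdivlMr ?ltr_wpDl// => he.
by have := normr_ge0 h; lra.
Unshelve. all: by end_near. Qed.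

(** * Linearization of the smoothed objective *)

Section Csig_taylor.
Context {R : realType} {n m k nc : nat}.
Variables (q : 'I_k -> 'I_m -> R) (q0 : 'I_k -> R) (rl : 'I_k -> arel).
Variables (phi : 'I_nc -> {ffun 'I_n -> bool} -> {ffun 'I_k -> bool} -> bool).
Variables (atoms : 'I_nc -> {set 'I_k}) (w : 'I_nc -> R) (sigma : R).
Hypothesis q_neq0 : forall i, exists j, q i j != 0.
Hypothesis phi_atoms : forall c x (z z' : {ffun 'I_k -> bool}),
  (forall i, i \in atoms c -> z i = z' i) -> phi c x z = phi c x z'.
Hypothesis w0 : forall c, 0 < w c.
Hypothesis sigma0 : 0 < sigma.
Local Notation C := (Csig q q0 rl phi w sigma).
Local Notation d := (dsmooth q q0 rl sigma).
Local Notation G := (gamma q atoms sigma).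

Definition relaxed_point (a : 'I_n -> R) (b : 'I_m -> R) (x : 'I_n + 'I_k) : R :=
  match x with inl i => a i | inr i => d i b end.

Lemma CsigE a b : C a b = \sum_c w c * fourier_sum phi c (relaxed_point a b).
Proof. by []. Qed.

Lemma alpha_ge0 : 0 <= alpha w.
Proof. by apply: sumr_ge0 => c _; exact: ltW. Qed.

Lemma relaxed_point_cube a b : (forall j, `|a j| <= 1) -> forall x, `|relaxed_point a b x| <= 1.
Proof. by move=> a1 [i|i] //=; apply: dsmooth_le1. Qed.

Lemma Csig_le_alpha a b : (forall j, `|a j| <= 1) -> `|C a b| <= alpha w.
Proof.
move=> a1; rewrite CsigE; apply: le_trans (ler_norm_sum _ _ _) _.
apply: ler_sum => c _; rewrite normrM (gtr0_norm (w0 c)) ler_piMr ?(ltW (w0 c))//.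
exact: (fourier_sum_bounded1 phi c (relaxed_point a b) (relaxed_point_cube a b a1)).
Qed.

Lemma gamma_ge0 : 0 <= G.
Proof.
by rewrite /gamma divr_ge0 ?mulr_ge0 ?sqrtr_ge0// ltW.
Qed.

(* Exchanging the sums over atoms and real variables, each variable is counted
   at most [beta] times. *)
Lemma sum_slope_le (c : 'I_nc) (v : 'I_m -> R) :
  \sum_(i in atoms c) slope sigma * \sum_(j | q i j != 0) `|v j| <=
  G * \sum_j `|v j|.
Proof.
have -> : G = slope sigma * (beta q atoms)%:R.
  by rewrite /gamma /slope mulrAC.
rewrite -mulr_sumr -mulrA ler_wpM2l//.
  by rewrite divr_ge0 ?sqrtr_ge0// mulr_ge0 ?sqrtr_ge0// ltW.
under eq_bigr do rewrite big_mkcond /=.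
rewrite exchange_big /= mulr_sumr; apply: ler_sum => j _.
rewrite -big_mkcondr /= (eq_bigl (mem [set i in atoms c | q i j != 0])); last first.
  by move=> i; rewrite !inE.
rewrite sumr_const -[leLHS]mulr_natl ler_wpM2r// ler_nat.
apply: leq_trans (leq_bigmax (F := fun c => \max_(j : 'I_m)
   #|[set i in atoms c | q i j != 0%R]|) c).
exact: (leq_bigmax (F := fun j : 'I_m => #|[set i in atoms c | q i j != 0%R]|) j).
Qed.

(** The multiaffine estimate is applied to each constraint and summed with weights. The slope [gb]
    comes from the chain rule with the linear coefficients of [dsmooth_taylor]; it is identified
    with the gradient afterwards. *)
Lemma Csig_taylor_ex a b : (forall j, `|a j| <= 1) -> exists gb : 'I_m -> R,
  forall (va : 'I_n -> R) (vb : 'I_m -> R), (forall j, `|a j + va j| <= 1) ->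
  `|C (fun j => a j + va j) (fun j => b j + vb j) - C a b
    - (\sum_j va j * (\sum_c w c * partial (inl j) (fourier_sum phi c) (relaxed_point a b))
       + \sum_j vb j * gb j)| <=
  alpha w * ((\sum_j `|va j| + G * \sum_j `|vb j|) ^+ 2 / 2).
Proof.
move=> a1.
have /choice [D DP] := fun i => dsmooth_taylor q q0 rl sigma i sigma0 (q_neq0 i).
pose F c : ('I_n + 'I_k -> R) -> R := fourier_sum phi c; pose r := relaxed_point a b.
exists (fun j => \sum_c w c * \sum_(i in atoms c) D i b j * partial (inr i) (F c) r).
move=> va vb av1; set s := relaxed_point (fun j => a j + va j) (fun j => b j + vb j).
pose Dx (x : 'I_n + 'I_k) := match x with
  | inl i => va i | inr i => \sum_j D i b j * vb j end.
pose rho (x : 'I_n + 'I_k) := match x with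
  | inl i => `|va i| | inr i => slope sigma * \sum_(j | q i j != 0) `|vb j| end.
(* Only the atoms of [c] are switched, so the sum of the [rho] is controlled by [sum_slope_le]. *)
pose l c := [seq inl i | i <- enum 'I_n] ++
  [seq inr i | i <- enum (atoms c)] : seq ('I_n + 'I_k).
have ul c : uniq (l c).
  rewrite cat_uniq; apply/and3P; split.
  - by rewrite map_inj_uniq ?enum_uniq// => ? ? [].
  - by apply/hasPn => _ /mapP[i _ ->]; apply/negP => /mapP[].
  - by rewrite map_inj_uniq ?enum_uniq// => ? ? [].
have big_l c (f : 'I_n + 'I_k -> R) :
    \sum_(x <- l c) f x = \sum_i f (inl i) + \sum_(i in atoms c) f (inr i).
  by rewrite big_cat !big_map !big_enum.
have Fs c : F c s = F c (hybrid r s (l c)).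
  apply: (fourier_sum_relevant phi c (atoms c) (phi_atoms c)) => i.
    by rewrite /hybrid mem_cat map_f ?mem_enum.
  by move=> iA; rewrite /hybrid mem_cat orbC map_f ?mem_enum.
have Tc c : `|F c s - F c r - \sum_(x <- l c) Dx x * partial x (F c) r| <=
    (\sum_j `|va j| + G * \sum_j `|vb j|) ^+ 2 / 2.
  rewrite Fs.
  have rho1 x : `|s x - r x| <= rho x.
    case: x => i; rewrite /s /r /=; first by rewrite addrAC subrr add0r.
    by have [] := DP i b vb.
  have rho2 x : `|s x - r x - Dx x| <= rho x ^+ 2 / 2.
    case: x => i; rewrite /s /r /=.
      rewrite (_ : _ - _ - _ = 0); last by ring.
      by rewrite normr0 divr_ge0 ?sqr_ge0.
    by have [] := DP i b vb.
  apply: le_trans (multiaffine_taylor (F c) r s (l c) Dx rho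
    (fourier_sum_multiaffine phi c) (fourier_sum_bounded1 phi c)
    (relaxed_point_cube a b a1) (relaxed_point_cube _ _ av1) (ul c) rho1 rho2) _.
  rewrite ler_pM2r// ler_pXn2r// ?nnegrE.
  - by rewrite big_l lerD2l sum_slope_le.
  - by rewrite sumr_ge0// => x _; exact: le_trans (rho1 x).
  - by rewrite addr_ge0 ?sumr_ge0// mulr_ge0 ?gamma_ge0 ?sumr_ge0.
(* Chain rule: the linear term is regrouped by constraints instead of by variables. *)
have LE : \sum_j va j * (\sum_c w c * partial (inl j) (F c) r) +
    \sum_j vb j * (\sum_c w c * \sum_(i in atoms c) D i b j * partial (inr i) (F c) r)
    = \sum_c w c * \sum_(x <- l c) Dx x * partial x (F c) r.
  under [RHS]eq_bigr => c _ do rewrite big_l mulrDr.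
  rewrite big_split /=; congr (_ + _).
    under eq_bigr do rewrite mulr_sumr.
    rewrite exchange_big /=; apply: eq_bigr => c _; rewrite mulr_sumr.
    by apply: eq_bigr => j _; rewrite mulrCA.
  under eq_bigr do rewrite mulr_sumr.
  rewrite exchange_big /=; apply: eq_bigr => c _.
  under eq_bigr do rewrite mulrCA mulr_sumr.
  rewrite -mulr_sumr exchange_big /=; congr (_ * _); apply: eq_bigr => i _.
  rewrite mulr_suml; apply: eq_bigr => j _; ring.
rewrite LE !CsigE -!sumrB -/s -/r /alpha mulr_suml.
apply: le_trans (ler_norm_sum _ _ _) _; apply: ler_sum => c _.
by rewrite -!mulrBr normrM (gtr0_norm (w0 c)) ler_pM2l.
Qed.

Lemma Csig_taylor a b (va : 'I_n -> R) (vb : 'I_m -> R) :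
  (forall j, `|a j| <= 1) -> (forall j, `|a j + va j| <= 1) ->
  `|C (fun j => a j + va j) (fun j => b j + vb j) - C a b
    - (\sum_j va j * (grad q q0 rl phi w sigma (a, b)).1 j +
       \sum_j vb j * (grad q q0 rl phi w sigma (a, b)).2 j)| <=
  alpha w * ((\sum_j `|va j| + G * \sum_j `|vb j|) ^+ 2 / 2).
Proof.
move=> a1 av1; set g := grad _ _ _ _ _ _ _; have [gb gbP] := Csig_taylor_ex a b a1.
have g1 j : g.1 j = \sum_c w c * partial (inl j) (fourier_sum phi c) (relaxed_point a b).
  (* The error is 0 by exact affinity in each [a j]. The estimate [gbP] would not do here, since on
     the boundary of the cube it allows increments to one side only. *)
  apply: (@derive1_quadratic_error _ _ _ _ 0) => h /=.
  have relaxed_pointE t : relaxed_point (upd a j t) b = set_coord (relaxed_point a b) (inl j) t.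
    by apply/funext => -[i|i].
  rewrite !CsigE !relaxed_pointE -sumrB mulr_sumr -sumrB big1 ?normr0 ?mul0r// => c _.
  rewrite -mulrBr multiaffine_diff; last exact: fourier_sum_multiaffine.
  by ring.
have g2 j : g.2 j = gb j.
  (* The constant is that of [gbP] for an increment in the single coordinate [j] of [b]. *)
  apply: (@derive1_quadratic_error _ _ _ _ (alpha w * (G ^+ 2 / 2))) => h /=.
  have := gbP (fun=> 0) (fun i => if i == j then h else 0).
  have -> : (fun i => b i + (if i == j then h else 0)) = upd b j (b j + h).
    by apply/funext => i; rewrite /upd; case: eqP => [->//|_]; rewrite addr0.
  have -> : upd b j (b j) = b by apply/funext => i; rewrite /upd; case: eqP => // ->.
  have -> : (fun i => a i + 0) = a by apply/funext => i; rewrite addr0.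
  have -> : \sum_i (if i == j then h else 0) * gb i = h * gb j.
    by rewrite (bigD1 j)//= eqxx big1 ?addr0// => i /negbTE ->; rewrite mul0r.
  have -> : \sum_(i < m) `|if i == j then h else 0| = `|h|.
    by rewrite (bigD1 j)//= eqxx big1 ?addr0// => i /negbTE ->; rewrite normr0.
  rewrite !big1 ?add0r => [H|i _|i _]; last 2 first.
  - by rewrite normr0.
  - by rewrite mul0r.
  apply: le_trans (H _) _; first by move=> i; rewrite addr0.
  by rewrite exprMn real_normK ?num_real//; lra.
under eq_bigr do rewrite g1.
have -> : \sum_j vb j * g.2 j = \sum_j vb j * gb j.
  by apply: eq_bigr => j _; rewrite g2.
exact: gbP.
Qed.

End Csig_taylor.

(** * Projection onto the feasible set and descent of the objective *)

Section descent.
Context {R : realType} {n m k nc : nat}.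
Variables (q : 'I_k -> 'I_m -> R) (q0 : 'I_k -> R) (rl : 'I_k -> arel).
Variables (phi : 'I_nc -> {ffun 'I_n -> bool} -> {ffun 'I_k -> bool} -> bool).
Variables (atoms : 'I_nc -> {set 'I_k}) (w : 'I_nc -> R) (sigma : R).
Hypothesis q_neq0 : forall i, exists j, q i j != 0.
Hypothesis phi_atoms : forall c x (z z' : {ffun 'I_k -> bool}),
  (forall i, i \in atoms c -> z i = z' i) -> phi c x z = phi c x z'.
Hypothesis w0 : forall c, 0 < w c.
Hypothesis sigma0 : 0 < sigma.
Local Notation C := (Csig q q0 rl phi w sigma).
Local Notation G := (gamma q atoms sigma).
Local Notation L := (@Lconst R n m k nc q atoms w sigma).
Local Notation D := (inD q q0 rl phi).
Local Notation grad := (grad q q0 rl phi w sigma).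
Local Notation pt := (@Defs.point R n m).
Implicit Types p r x : pt.

Definition dot p r : R := \sum_j p.1 j * r.1 j + \sum_j p.2 j * r.2 j.

Definition segment p r (t : R) : pt :=
  (fun j => p.1 j + t * (r.1 j - p.1 j), fun j => p.2 j + t * (r.2 j - p.2 j)).

Lemma inD_cube p : D p -> forall j, `|p.1 j| <= 1.
Proof. by move=> [p1 _] j; rewrite ler_norml. Qed.

(** The affine form of an atom interpolates linearly along the segment, and each of the five
    relations defines a convex subset of the line. *)
Lemma inD_convex p r t : D p -> D r -> 0 <= t <= 1 -> D (segment p r t).
Proof.
move=> [p1 p2] [r1 r2] /andP[t0 t1]; split => [j|c i ci] /=.
  have /andP[? ?] := p1 j; have /andP[? ?] := r1 j.
  by apply/andP; split; nra.
have := p2 c i ci; have := r2 c i ci; rewrite /atom_holds.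
have -> : \sum_j q i j * (p.2 j + t * (r.2 j - p.2 j)) - q0 i =
    (1 - t) * (\sum_j q i j * p.2 j - q0 i) + t * (\sum_j q i j * r.2 j - q0 i).
  rewrite !mulrBr !mulr_sumr addrACA -opprD -big_split /=.
  congr (_ - _); last by ring.
  by apply: eq_bigr => j _; ring.
move: (\sum_j _ - _) (\sum_j _ - _) => u v.
by case: (rl i) => [? ?|? ?|/eqP-> /eqP->|? ?|? ?]; rewrite ?mulr0 ?addr0//; nra.
Qed.

Lemma sqnorm_segment p r x t :
  sqnorm (pt_sub (segment p r t) x) = sqnorm (pt_sub p x) +
  2 * t * dot (pt_sub p x) (pt_sub r p) + t ^+ 2 * sqnorm (pt_sub r p).
Proof.
have E (J : finType) (f g h : J -> R) :
    \sum_j (f j + t * (g j - f j) - h j) ^+ 2 = \sum_j (f j - h j) ^+ 2 +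
    2 * t * (\sum_j (f j - h j) * (g j - f j)) + t ^+ 2 * \sum_j (g j - f j) ^+ 2.
  rewrite !mulr_sumr -!big_split /=; apply: eq_bigr => j _; ring.
by rewrite /sqnorm /dot /= !E; ring.
Qed.

Lemma sqnorm_ge0 p : 0 <= sqnorm p.
Proof. by rewrite addr_ge0// sumr_ge0// => j _; rewrite sqr_ge0. Qed.

Lemma sqnorm_scale e p : sqnorm (pt_scale e p) = e ^+ 2 * sqnorm p.
Proof.
rewrite /sqnorm /= mulrDr !mulr_sumr.
by congr (_ + _); apply: eq_bigr => j _; rewrite exprMn.
Qed.

(** Minimality of the distance is tested at points of the segment from [proj x] to [r]; a negative
    inner product would bring short steps closer to [x]. *)
Lemma proj_variational proj x r : is_projD q q0 rl phi proj -> D r ->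
  0 <= dot (pt_sub (proj x) x) (pt_sub r (proj x)).
Proof.
move=> pP Dr; have [Dp pmin] := pP x.
set p := proj x in Dp pmin *; set d := dot _ _; set N := sqnorm (pt_sub r p).
have N0 : 0 <= N by exact: sqnorm_ge0.
have H t : 0 < t <= 1 -> 0 <= 2 * d + t * N.
  move=> /andP[t0 t1]; have t01 : 0 <= t <= 1 by rewrite ltW.
  have := pmin _ (inD_convex p r t Dp Dr t01).
  rewrite sqnorm_segment -/d -/N -addrA lerDl => H.
  by rewrite -(pmulr_rge0 _ t0); lra.
rewrite leNgt; apply/negP => d0.
have N1 : 0 < N + 1 by lra.
(* Small enough that [2 * d + t * N <= d < 0]; [N + 1] avoids division by zero. *)
pose t := Num.min 1 (- d / (N + 1)).
have t0 : 0 < t by rewrite lt_min ltr01 divr_gt0// oppr_gt0.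
have t1 : t <= 1 by rewrite ge_min lexx.
have : t * (N + 1) <= - d.
  by rewrite -ler_pdivlMr// ge_min lexx orbT.
by have := H t; rewrite t0 t1 => /(_ isT); nra.
Qed.

(** Cauchy-Schwarz against the vector with [n] entries 1 and [m] entries [g], obtained by expanding
    a nonnegative sum of squares equal to [N * (N * sqnorm p - S ^+ 2)]. *)
Lemma sum_norm_sqr_le p (g : R) : 0 < n%:R + m%:R * g ^+ 2 ->
  (\sum_j `|p.1 j| + g * \sum_j `|p.2 j|) ^+ 2 <=
  (n%:R + m%:R * g ^+ 2) * sqnorm p.
Proof.
set N := _ + _ => N0; set S := _ + _.
have E1 (j : 'I_n) : (N * `|p.1 j| - S) ^+ 2 =
   N ^+ 2 * p.1 j ^+ 2 - 2 * N * S * `|p.1 j| + S ^+ 2.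
  by rewrite -[p.1 j ^+ 2](real_normK (num_real _)); ring.
have E2 (j : 'I_m) : (N * `|p.2 j| - g * S) ^+ 2 =
   N ^+ 2 * p.2 j ^+ 2 - 2 * N * S * g * `|p.2 j| + g ^+ 2 * S ^+ 2.
  by rewrite -[p.2 j ^+ 2](real_normK (num_real _)); ring.
have : 0 <= \sum_j (N * `|p.1 j| - S) ^+ 2 + \sum_j (N * `|p.2 j| - g * S) ^+ 2.
  by rewrite addr_ge0// sumr_ge0// => j _; rewrite sqr_ge0.
under eq_bigr do rewrite E1.
under [X in _ + X]eq_bigr do rewrite E2.
rewrite !big_split /= !sumr_const !card_ord !sumrN -!mulr_sumr.
rewrite -[S ^+ 2 *+ n]mulr_natl -[_ * S ^+ 2 *+ m]mulr_natl => H.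
have {H} H : 0 <= N * (N * sqnorm p - S ^+ 2).
  have E3 : N * S * S = N * S * \sum_j `|p.1 j| + N * S * g * \sum_j `|p.2 j|.
    by rewrite {2}/S; ring.
  have E4 : N * S ^+ 2 = n%:R * S ^+ 2 + m%:R * (g ^+ 2 * S ^+ 2).
    by rewrite {1}/N; ring.
  by move: H E3 E4; rewrite /sqnorm; clearbody S N; lra.
by rewrite -subr_ge0 -(pmulr_rge0 _ N0).
Qed.

Lemma Lconst_ge0 : 0 <= L.
Proof. by rewrite !mulr_ge0 ?sqrtr_ge0 ?alpha_ge0// le_max ler01. Qed.

(** With [N = n + m * G ^+ 2], one factor [Num.sqrt N] of [N] is kept and the other is bounded by
    [Num.sqrt (n + m) * Num.max 1 G]. *)
Lemma Lconst_gt0 : L != 0 ->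
  0 < n%:R + m%:R * G ^+ 2 /\ alpha w * (n%:R + m%:R * G ^+ 2) <= L.
Proof.
rewrite /Lconst => L0; set N := n%:R + m%:R * G ^+ 2 in L0 *.
have N0 : 0 <= N by rewrite addr_ge0// mulr_ge0// sqr_ge0.
have {L0} Nn0 : N != 0.
  by apply: contraNneq L0 => ->; rewrite sqrtr0 !mul0r.
split; first by rewrite lt_def Nn0.
rewrite -{1}(sqr_sqrtr N0) expr2 [leRHS](_ : _ = alpha w * (Num.sqrt N *
  (Num.sqrt (n + m)%:R * Num.max 1 G))); last by ring.
rewrite ler_wpM2l ?alpha_ge0// ler_wpM2l ?sqrtr_ge0//.
have M1 : 1 <= Num.max 1 G by rewrite le_max lexx.
have M0 : 0 <= Num.max 1 G by rewrite (le_trans _ M1).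
have MG : G <= Num.max 1 G by rewrite le_max lexx orbT.
have G0 : 0 <= G by exact: gamma_ge0.
rewrite -[X in _ * X](ger0_norm M0) -sqrtr_sqr -sqrtrM// ler_wsqrtr//.
rewrite natrD mulrDl lerD//.
  by rewrite ler_peMr// exprn_ege1.
by rewrite ler_wpM2l// ler_pXn2r.
Qed.

Lemma Csig_descent p r : L != 0 -> D p -> D r ->
  C r.1 r.2 <= C p.1 p.2 + dot (grad p) (pt_sub r p) + L / 2 * sqnorm (pt_sub r p).
Proof.
move=> /Lconst_gt0[N0 NL] Dp Dr.
have p1 := inD_cube p Dp; have r1 := inD_cube r Dr.
have := Csig_taylor q q0 rl phi atoms w sigma q_neq0 phi_atoms w0 sigma0
  p.1 p.2 (pt_sub r p).1 (pt_sub r p).2 p1.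
have -> : (fun j => p.1 j + (pt_sub r p).1 j) = r.1.
  by apply/funext => j /=; rewrite addrC subrK.
have -> : (fun j => p.2 j + (pt_sub r p).2 j) = r.2.
  by apply/funext => j /=; rewrite addrC subrK.
rewrite -surjective_pairing => H.
have {}H : `|C r.1 r.2 - C p.1 p.2 - dot (grad p) (pt_sub r p)| <=
    alpha w * ((\sum_j `|(pt_sub r p).1 j| + G * \sum_j `|(pt_sub r p).2 j|) ^+ 2 / 2).
  have <- : \sum_j (pt_sub r p).1 j * (grad p).1 j +
      \sum_j (pt_sub r p).2 j * (grad p).2 j = dot (grad p) (pt_sub r p).
    by congr (_ + _); apply: eq_bigr => j _; rewrite mulrC.
  by apply: H => j /=; rewrite addrC subrK.
have S := sum_norm_sqr_le (pt_sub r p) G N0.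
have A1 := ler_wpM2l (alpha_ge0 w w0) S.
have A2 := ler_wpM2r (sqnorm_ge0 (pt_sub r p)) NL.
by move: H; rewrite ler_norml => /andP[_ H]; lra.
Qed.

Variable proj : pt -> pt.
Hypothesis projP : is_projD q q0 rl phi proj.
Local Notation step := (pgd_step q q0 rl phi w proj sigma L^-1).
Local Notation gm := (gmap q q0 rl phi w proj sigma L^-1).

Lemma pgd_step_inD p : D (step p).
Proof. exact: (projP _).1. Qed.

(** The variational inequality at [p] itself makes the linear term at most [- L * N], where [N] is
    the squared step length. The quadratic term returns [L / 2 * N], and [N] is the squared norm of
    the gradient mapping divided by [L ^+ 2]. *)
Lemma pgd_step_decrease p : L != 0 -> D p ->
  C (step p).1 (step p).2 <= C p.1 p.2 - sqnorm (gm p) / (2 * L).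
Proof.
move=> Ln0 Dp; have L0 : 0 < L by rewrite lt_def Ln0 Lconst_ge0.
apply: le_trans (Csig_descent p (step p) Ln0 Dp (pgd_step_inD p)) _.
rewrite /gmap invrK sqnorm_scale.
set r := step p; set N := sqnorm (pt_sub r p).
have -> : sqnorm (pt_sub p r) = N.
  by congr (_ + _); apply: eq_bigr => j _; rewrite /= -sqrrN opprB.
have : dot (grad p) (pt_sub r p) <= - L * N.
  have := proj_variational proj (pt_sub p (pt_scale L^-1 (grad p))) p projP Dp.
  rewrite -/r => H.
  have E : dot (pt_sub r (pt_sub p (pt_scale L^-1 (grad p)))) (pt_sub p r) =
      - N - L^-1 * dot (grad p) (pt_sub r p).
    have F (J : finType) (f g h : J -> R) :
        \sum_j (f j - (g j - L^-1 * h j)) * (g j - f j) =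
        - (\sum_j (f j - g j) ^+ 2) - L^-1 * \sum_j h j * (f j - g j).
      rewrite mulr_sumr -sumrN -sumrB; apply: eq_bigr => j _; ring.
    by rewrite /N /dot /sqnorm /= !F; ring.
  move: H; rewrite E => H.
  have : 0 <= L * (- N - L^-1 * dot (grad p) (pt_sub r p)).
    by rewrite mulr_ge0// ltW.
  by rewrite mulrBr mulrA divff// mul1r; lra.
have -> : L ^+ 2 * N / (2 * L) = L / 2 * N by field.
by lra.
Qed.

Lemma pgd_telescope p (eps : R) T : L != 0 -> D p ->
  (forall t, (t < T)%N -> eps <= sqnorm (gm (iter t step p))) ->
  D (iter T step p) /\
  C (iter T step p).1 (iter T step p).2 <= C p.1 p.2 - T%:R * (eps / (2 * L)).
Proof.
move=> Ln0 Dp; have L0 : 0 < L by rewrite lt_def Ln0 Lconst_ge0.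
elim: T => [|T IH] H; first by split=> //; rewrite mul0r subr0.
have [DT CT] := IH (fun t tT => H t (ltnW tT)).
split; first exact: pgd_step_inD.
have S := pgd_step_decrease (iter T step p) Ln0 DT.
have E : eps / (2 * L) <= sqnorm (gm (iter T step p)) / (2 * L).
  rewrite ler_pM2r; last by rewrite invr_gt0 mulr_gt0.
  exact: H T (ltnSn T).
by rewrite iterS -natr1 mulrDl mul1r; lra.
Qed.

End descent.

(** * The iteration count *)

Theorem theorem7 :
  exists K : nat, (0 < K)%N /\
  forall (R : realType) (n m k nc : nat)
    (q : 'I_k -> 'I_m -> R) (q0 : 'I_k -> R) (rl : 'I_k -> arel)
    (phi : 'I_nc -> {ffun 'I_n -> bool} -> {ffun 'I_k -> bool} -> bool)
    (atoms : 'I_nc -> {set 'I_k}) (w : 'I_nc -> R)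
    (sigma eps : R) (proj : @Defs.point R n m -> @Defs.point R n m) (p0 : @Defs.point R n m),
    (forall i, exists j, q i j != 0) ->
    (forall c x (z z' : {ffun 'I_k -> bool}), (forall i, i \in atoms c -> z i = z' i) ->
        phi c x z = phi c x z') ->
    (forall c, 0 < w c) ->
    0 < sigma -> 0 < eps ->
    is_projD q q0 rl phi proj ->
    inD q q0 rl phi p0 ->
    let L := @Lconst R n m k nc q atoms w sigma in
    let eta := L^-1 in
    exists t : nat,
      t%:R <= K%:R * alpha w * L / eps ^+ 2 /\
      sqnorm (gmap q q0 rl phi w proj sigma eta
                (iter t (pgd_step q q0 rl phi w proj sigma eta) p0)) <= eps ^+ 2.
Proof.
(* The total decrease is at most [2 * alpha], and each unsuccessful step costs at least
   [eps ^+ 2 / (2 * L)]; the quotient gives the factor 4. *)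
exists 4%N; split=> // R n m k nc q q0 rl phi atoms w sigma eps proj p0 q_neq0
  phi_atoms w0 sigma0 eps0 projP Dp0 L eta.
have e2 : 0 < eps ^+ 2 by rewrite exprn_gt0.
have L0 : 0 <= L by exact: Lconst_ge0.
have a0 : 0 <= alpha w by exact: alpha_ge0.
have [Lz|Ln0] := eqVneq L 0.
  (* Here [eta = 1 / 0 = 0], hence the gradient mapping vanishes. *)
  exists 0%N; rewrite Lz mulr0 mul0r lexx; split=> //.
  by rewrite /gmap sqnorm_scale /eta Lz !invr0 expr0n mul0r ltW.
set X := _ / _; have X0 : 0 <= X.
  by apply: divr_ge0; [rewrite mulr_ge0// mulr_ge0|exact: ltW].
(* [T] exceeds the bound [X], while every [t < T] still satisfies [t <= X]. If none of these
   iterates succeeds, the telescoped decrease forces [T <= X]. *)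
pose T := (Num.truncn X).+1.
have XT : X < T%:R by have /andP[_] := truncn_itv X0.
set step := pgd_step _ _ _ _ _ _ _ _.
apply: contrapT => noT.
have H t : (t < T)%N -> eps ^+ 2 <= sqnorm (gmap q q0 rl phi w proj sigma eta
                (iter t step p0)).
  move=> tT; rewrite leNgt; apply/negP => gt; apply: noT; exists t; split.
    have /andP[TX _] := truncn_itv X0; apply: le_trans TX.
    by rewrite ler_nat -ltnS.
  exact: ltW.
have [DT CT] := pgd_telescope q q0 rl phi atoms w sigma q_neq0 phi_atoms w0
  sigma0 proj projP p0 (eps ^+ 2) T Ln0 Dp0 H.
have := Csig_le_alpha q q0 rl phi w sigma q_neq0 w0 sigma0 p0.1 p0.2
  (inD_cube _ _ _ _ _ Dp0).
have := Csig_le_alpha q q0 rl phi w sigma q_neq0 w0 sigma0 _ (iter T step p0).2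
  (inD_cube _ _ _ _ _ DT).
rewrite !ler_norml => /andP[lo _] /andP[_ hi].
have B : T%:R * (eps ^+ 2 / (2 * L)) <= 2 * alpha w by rewrite -/L in CT; lra.
have L1 : 0 < L by rewrite lt_def Ln0.
move: XT; rewrite ltNge => /negP; apply.
rewrite /X ler_pdivlMr//.
have : T%:R * (eps ^+ 2 / (2 * L)) * (2 * L) <= 2 * alpha w * (2 * L).
  by rewrite ler_pM2r// mulr_gt0.
have -> : T%:R * (eps ^+ 2 / (2 * L)) * (2 * L) = T%:R * eps ^+ 2 by field.
by lra.
Qed.
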